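(* Let $X_1,X_2$ be loops. The following conditions are equivalent for a subloop $A\le X_1\times X_2$: (i) $A\unlhd X_1\times X_2$; (ii) there exist normal subloops $M_1\unlhd X_1$, $M_2\unlhd X_2$ such that $A$ is a subdirect product of $M_1\times M_2$, and, with $N_i=A[i]_i$, we have $N_i\unlhd X_i$ and $M_i/N_i\le Z(X_i/N_i)$ for $i=1,2$. If the equivalent conditions are satisfied then $(X_1\times X_2)/A\cong (X_1/N_1\times X_2/N_2)/\mathbf G(\varphi)$ for some isomorphism $\varphi\colon M_1/N_1\to M_2/N_2$.
   Context: A loop is an algebra $(X,\cdot,\backslash,/,e)$ satisfying $x(x\backslash y)=y=x\backslash(xy)$, $(x/y)y=x=(xy)/y$ and $ex=xe=x$. Write $A\le X$ for subloops and $A\unlhd X$ for normal subloops (kernels of loop homomorphisms; equivalently, subloops invariant under the inner mapping group $\mathrm{Inn}(X)$, the group generated by $L_{yx}^{-1}L_yL_x$, $R_{xy}^{-1}R_yR_x$, $R_x^{-1}L_x$ for $x,y\in X$, where $L_x(y)=xy$, $R_x(y)=yx$). The center $Z(X)$ consists of the elements of $X$ fixed by all of $\mathrm{Inn}(X)$. For $A\le X_1\times X_2$, $A[1]_1=\{x\in X_1:(x,e)\in A\}$ and $A[2]_2=\{x\in X_2:(e,x)\in A\}$. A subloop $A$ of $M_1\times M_2$ is a subdirect product of $M_1\times M_2$ if the coordinate projections map $A$ onto $M_1$ and $M_2$, respectively. For a mapping $\varphi\colon K_1\to K_2$, $\mathbf G(\varphi)=\{(x,\varphi(x)):x\in K_1\}$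 is its graph. *)

(* Defs.v *)
From HB Require Import structures.
From mathcomp Require Import all_boot.
From mathcomp Require Import boolp classical_sets.

Set Implicit Arguments.
Unset Strict Implicit.
Unset Printing Implicit Defensive.

Local Open Scope classical_set_scope.
Local Open Scope group_scope.

(* The product of X and the neutral element e are the [*] and [1] of the
   underlying pointed magma; [ldiv x y] is x\y and [rdiv x y] is x/y. *)
HB.mixin Record BaseUMagma_isLoop X of BaseUMagma X := {
  ldiv : X -> X -> X;
  rdiv : X -> X -> X;
  mul_ldiv : forall x y : X, x * ldiv x y = y;
  ldiv_mul : forall x y : X, ldiv x (x * y) = y;
  rdiv_mul : forall x y : X, rdiv x y * y = x;
  mul_rdiv : forall x y : X, rdiv (x * y) y = x;
  loop_mul1l : forall x : X, 1 * x = x;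
  loop_mul1r : forall x : X, x * 1 = x
}.

#[short(type="loopType")]
HB.structure Definition Loop := {X of BaseUMagma_isLoop X & BaseUMagma X}.

Section ProductLoop.
Variables X Y : loopType.

Definition pair_ldiv (u v : X * Y) : X * Y := (ldiv u.1 v.1, ldiv u.2 v.2).
Definition pair_rdiv (u v : X * Y) : X * Y := (rdiv u.1 v.1, rdiv u.2 v.2).

Lemma pair_mul_ldiv (u v : X * Y) : u * pair_ldiv u v = v.
Proof.
by case: u v => [a b] [c d]; congr (_, _); rewrite /= mul_ldiv.
Qed.

Lemma pair_ldiv_mul (u v : X * Y) : pair_ldiv u (u * v) = v.
Proof.
by case: u v => [a b] [c d]; congr (_, _); rewrite /= ldiv_mul.
Qed.

Lemma pair_rdiv_mul (u v : X * Y) : pair_rdiv u v * v = u.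
Proof.
by case: u v => [a b] [c d]; congr (_, _); rewrite /= rdiv_mul.
Qed.

Lemma pair_mul_rdiv (u v : X * Y) : pair_rdiv (u * v) v = u.
Proof.
by case: u v => [a b] [c d]; congr (_, _); rewrite /= mul_rdiv.
Qed.

Lemma pair_mul1 (u : X * Y) : 1 * u = u.
Proof. by case: u => [a b]; congr (_, _); rewrite /= loop_mul1l. Qed.

Lemma pair_mulr1 (u : X * Y) : u * 1 = u.
Proof. by case: u => [a b]; congr (_, _); rewrite /= loop_mul1r. Qed.

HB.instance Definition _ := BaseUMagma_isLoop.Build (X * Y)%type
  pair_mul_ldiv pair_ldiv_mul pair_rdiv_mul pair_mul_rdiv pair_mul1 pair_mulr1.

End ProductLoop.

Record loop_morphism (X Y : loopType) (f : X -> Y) : Prop := LoopMorphism {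
  morph_one : f 1 = 1;
  morph_mul : forall x y, f (x * y) = f x * f y;
  morph_ldiv : forall x y, f (ldiv x y) = ldiv (f x) (f y);
  morph_rdiv : forall x y, f (rdiv x y) = rdiv (f x) (f y)
}.

Definition loop_isomorphism (X Y : loopType) (f : X -> Y) : Prop :=
  loop_morphism f /\ bijective f.

Definition loop_isomorphic (X Y : loopType) : Prop :=
  exists f : X -> Y, loop_isomorphism f.

Record subloop (X : loopType) (A : set X) : Prop := Subloop {
  subloop_one : A 1;
  subloop_mul : forall x y, A x -> A y -> A (x * y);
  subloop_ldiv : forall x y, A x -> A y -> A (ldiv x y);
  subloop_rdiv : forall x y, A x -> A y -> A (rdiv x y)
}.

Definition normal (X : loopType) (N : set X) : Prop :=
  exists (Y : loopType) (f : X -> Y),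
    loop_morphism f /\ N = [set x | f x = 1].

Lemma normal_subloop (X : loopType) (N : set X) : normal N -> subloop N.
Proof.
case=> Y [f [[f1 fM fl fr] ->]]; split=> [|x y|x y|x y] /=; first exact: f1.
- by move=> fx fy; rewrite fM fx fy loop_mul1l.
- by move=> fx fy; rewrite fl fx fy -[X in ldiv _ X](loop_mul1l 1) ldiv_mul.
- by move=> fx fy; rewrite fr fx fy -[X in rdiv X _](loop_mul1l 1) mul_rdiv.
Qed.

(* Permutations are plain functions; composition is right to left. *)
Inductive Inn (X : loopType) : (X -> X) -> Prop :=
| Inn_LL x y : Inn (fun z => ldiv (y * x) (y * (x * z)))
| Inn_RR x y : Inn (fun z => rdiv ((z * x) * y) (x * y))
| Inn_RL x : Inn (fun z => rdiv (x * z) x)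
| Inn_id : Inn idfun
| Inn_comp f g : Inn f -> Inn g -> Inn (f \o g)
| Inn_inv f g : Inn f -> cancel f g -> cancel g f -> Inn g.

Definition center (X : loopType) : set X :=
  [set x | forall f : X -> X, Inn f -> f x = x].

Arguments center : clear implicits.

Section SubloopType.
Variables (X : loopType) (A : set X) (hA : subloop A).

Definition subloop_of (_ : subloop A) : Type := {x : X | A x}.
Local Notation S := (subloop_of hA).

Definition sub_mul (u v : S) : S :=
  exist _ (sval u * sval v) (subloop_mul hA (svalP u) (svalP v)).
Definition sub_one : S := exist _ 1 (subloop_one hA).
Definition sub_ldiv (u v : S) : S :=
  exist _ (ldiv (sval u) (sval v)) (subloop_ldiv hA (svalP u) (svalP v)).
Definition sub_rdiv (u v : S) : S :=
  exist _ (rdiv (sval u) (sval v)) (subloop_rdiv hA (svalP u) (svalP v)).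

Lemma subloop_of_inj (u v : S) : sval u = sval v -> u = v.
Proof.
case: u v => [x Ax] [y Ay] /= e; move: Ax Ay; rewrite e => Ax Ay.
by rewrite (Prop_irrelevance Ax Ay).
Qed.

HB.instance Definition _ := hasMul.Build S sub_mul.
HB.instance Definition _ := hasOne.Build S sub_one.

Lemma sub_mul_ldiv (u v : S) : u * sub_ldiv u v = v.
Proof. by apply: subloop_of_inj; rewrite /= mul_ldiv. Qed.

Lemma sub_ldiv_mul (u v : S) : sub_ldiv u (u * v) = v.
Proof. by apply: subloop_of_inj; rewrite /= ldiv_mul. Qed.

Lemma sub_rdiv_mul (u v : S) : sub_rdiv u v * v = u.
Proof. by apply: subloop_of_inj; rewrite /= rdiv_mul. Qed.

Lemma sub_mul_rdiv (u v : S) : sub_rdiv (u * v) v = u.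
Proof. by apply: subloop_of_inj; rewrite /= mul_rdiv. Qed.

Lemma sub_mul1 (u : S) : 1 * u = u.
Proof. by apply: subloop_of_inj; rewrite /= loop_mul1l. Qed.

Lemma sub_mulr1 (u : S) : u * 1 = u.
Proof. by apply: subloop_of_inj; rewrite /= loop_mul1r. Qed.

HB.instance Definition _ := BaseUMagma_isLoop.Build S
  sub_mul_ldiv sub_ldiv_mul sub_rdiv_mul sub_mul_rdiv sub_mul1 sub_mulr1.

End SubloopType.

Definition lcoset (X : loopType) (N : set X) (x : X) : set X :=
  [set x * n | n in N].

(* For N normal the setwise product of the cosets xN and yN is the coset
   (xy)N, and similarly for both divisions; hence no representatives need to
   be chosen to define the operations of X/N. *)
Section QuotientLoop.
Variables (X : loopType) (N : set X) (hN : normal N).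

Definition quotient (_ : normal N) : Type :=
  {C : set X | exists x, C = lcoset N x}.
Local Notation Q := (quotient hN).

Definition quo (x : X) : Q := exist _ (lcoset N x) (ex_intro _ x erefl).

Lemma quotient_inj (C D : Q) : sval C = sval D -> C = D.
Proof.
case: C D => [C hC] [D hD] /= e; move: hC hD; rewrite e => hC hD.
by rewrite (Prop_irrelevance hC hD).
Qed.

Lemma lcoset_fiber (Y : loopType) (f : X -> Y) (x : X) :
  loop_morphism f -> N = [set z | f z = 1] ->
  lcoset N x = [set z | f z = f x].
Proof.
case=> _ fM fl _ ->; apply/seteqP; split=> z /=.
  by case=> n /= fn <-; rewrite fM fn loop_mul1r.
move=> fz; exists (ldiv x z); last exact: mul_ldiv.
by rewrite /= fl fz -[X in ldiv _ X]loop_mul1r ldiv_mul.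
Qed.

Lemma lcoset_mul (x y : X) :
  [set s * t | s in lcoset N x & t in lcoset N y] = lcoset N (x * y).
Proof.
case: hN => Y [f [fm eN]]; rewrite !(lcoset_fiber _ fm eN).
apply/seteqP; split=> z /=.
  by case=> s fs [t ft <-]; rewrite !(morph_mul fm) fs ft.
rewrite (morph_mul fm) => fz; exists x => //; exists (ldiv x z).
  by rewrite (morph_ldiv fm) fz ldiv_mul.
exact: mul_ldiv.
Qed.

Lemma lcoset_ldiv (x y : X) :
  [set ldiv s t | s in lcoset N x & t in lcoset N y] = lcoset N (ldiv x y).
Proof.
case: hN => Y [f [fm eN]]; rewrite !(lcoset_fiber _ fm eN).
apply/seteqP; split=> z /=.
  by case=> s fs [t ft <-]; rewrite !(morph_ldiv fm) fs ft.
rewrite (morph_ldiv fm) => fz; exists x => //; exists (x * z).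
  by rewrite (morph_mul fm) fz mul_ldiv.
exact: ldiv_mul.
Qed.

Lemma lcoset_rdiv (x y : X) :
  [set rdiv s t | s in lcoset N x & t in lcoset N y] = lcoset N (rdiv x y).
Proof.
case: hN => Y [f [fm eN]]; rewrite !(lcoset_fiber _ fm eN).
apply/seteqP; split=> z /=.
  by case=> s fs [t ft <-]; rewrite !(morph_rdiv fm) fs ft.
rewrite (morph_rdiv fm) => fz; exists (z * y).
  by rewrite (morph_mul fm) fz rdiv_mul.
by exists y => //; exact: mul_rdiv.
Qed.

Lemma quoP (C : Q) : exists x, C = quo x.
Proof. by case: C => C [x e]; exists x; exact: quotient_inj. Qed.

Lemma quo_mul_subproof (C D : Q) :
  exists x, [set s * t | s in sval C & t in sval D] = lcoset N x.
Proof.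
have [[x ->] [y ->]] := (quoP C, quoP D).
by exists (x * y); exact: lcoset_mul.
Qed.

Lemma quo_ldiv_subproof (C D : Q) :
  exists x, [set ldiv s t | s in sval C & t in sval D] = lcoset N x.
Proof.
have [[x ->] [y ->]] := (quoP C, quoP D).
by exists (ldiv x y); exact: lcoset_ldiv.
Qed.

Lemma quo_rdiv_subproof (C D : Q) :
  exists x, [set rdiv s t | s in sval C & t in sval D] = lcoset N x.
Proof.
have [[x ->] [y ->]] := (quoP C, quoP D).
by exists (rdiv x y); exact: lcoset_rdiv.
Qed.

Definition quo_mul (C D : Q) : Q := exist _ _ (quo_mul_subproof C D).
Definition quo_one : Q := quo 1.
Definition quo_ldiv (C D : Q) : Q := exist _ _ (quo_ldiv_subproof C D).
Definition quo_rdiv (C D : Q) : Q := exist _ _ (quo_rdiv_subproof C D).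

Lemma quo_mulE (x y : X) : quo_mul (quo x) (quo y) = quo (x * y).
Proof. by apply: quotient_inj; exact: lcoset_mul. Qed.

Lemma quo_ldivE (x y : X) : quo_ldiv (quo x) (quo y) = quo (ldiv x y).
Proof. by apply: quotient_inj; exact: lcoset_ldiv. Qed.

Lemma quo_rdivE (x y : X) : quo_rdiv (quo x) (quo y) = quo (rdiv x y).
Proof. by apply: quotient_inj; exact: lcoset_rdiv. Qed.

HB.instance Definition _ := hasMul.Build Q quo_mul.
HB.instance Definition _ := hasOne.Build Q quo_one.

Lemma quo_mul_ldiv (C D : Q) : C * quo_ldiv C D = D.
Proof.
have [[x ->] [y ->]] := (quoP C, quoP D).
by rewrite quo_ldivE [LHS]quo_mulE mul_ldiv.
Qed.

Lemma quo_ldiv_mul (C D : Q) : quo_ldiv C (C * D) = D.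
Proof.
have [[x ->] [y ->]] := (quoP C, quoP D).
by rewrite [_ * _]quo_mulE quo_ldivE ldiv_mul.
Qed.

Lemma quo_rdiv_mul (C D : Q) : quo_rdiv C D * D = C.
Proof.
have [[x ->] [y ->]] := (quoP C, quoP D).
by rewrite quo_rdivE [LHS]quo_mulE rdiv_mul.
Qed.

Lemma quo_mul_rdiv (C D : Q) : quo_rdiv (C * D) D = C.
Proof.
have [[x ->] [y ->]] := (quoP C, quoP D).
by rewrite [_ * _]quo_mulE quo_rdivE mul_rdiv.
Qed.

Lemma quo_mul1l (C : Q) : 1 * C = C.
Proof. by have [x ->] := quoP C; rewrite [LHS]quo_mulE loop_mul1l. Qed.

Lemma quo_mul1r (C : Q) : C * 1 = C.
Proof. by have [x ->] := quoP C; rewrite [LHS]quo_mulE loop_mul1r. Qed.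

HB.instance Definition _ := BaseUMagma_isLoop.Build Q
  quo_mul_ldiv quo_ldiv_mul quo_rdiv_mul quo_mul_rdiv quo_mul1l quo_mul1r.

Lemma quo_morphism : loop_morphism quo.
Proof. by split=> // x y; rewrite -?quo_mulE -?quo_ldivE -?quo_rdivE. Qed.

End QuotientLoop.

Arguments quo {X N} hN x.

(* For N <= M, the subloop M/N of X/N: the cosets xN with x in M. *)
Definition sub_quotient (X : loopType) (M N : set X) (hN : normal N) :
    set (quotient hN) := [set quo hN x | x in M].

Arguments sub_quotient {X} M {N} hN.

Lemma sub_quotient_subloop (X : loopType) (M N : set X) (hN : normal N) :
  subloop M -> subloop (sub_quotient M hN).
Proof.
case=> M1 MM Ml Mr; have [q1 qM ql qr] := quo_morphism hN; split.
- by exists 1.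
- by move=> _ _ [x Mx <-] [y My <-]; exists (x * y); [exact: MM | exact: qM].
- by move=> _ _ [x Mx <-] [y My <-]; exists (ldiv x y); [exact: Ml | exact: ql].
- by move=> _ _ [x Mx <-] [y My <-]; exists (rdiv x y); [exact: Mr | exact: qr].
Qed.

Section SubdirectProduct.
Variables X1 X2 : loopType.

Definition section1 (A : set (X1 * X2)) : set X1 := [set x | A (x, 1)].
Definition section2 (A : set (X1 * X2)) : set X2 := [set x | A (1, x)].

Definition subdirect (A : set (X1 * X2)) (M1 : set X1) (M2 : set X2) : Prop :=
  [/\ subloop A, A `<=` M1 `*` M2, fst @` A = M1 & snd @` A = M2].

Definition graph (K1 : set X1) (K2 : set X2) (h1 : subloop K1)
    (h2 : subloop K2) (phi : subloop_of h1 -> subloop_of h2) : set (X1 * X2) :=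
  [set p | exists x : subloop_of h1, p = (sval x, sval (phi x))].

End SubdirectProduct.

(* Main.v *)
Require Import Defs.
From HB Require Import structures.
From mathcomp Require Import all_boot.
From mathcomp Require Import boolp classical_sets.

(* Central elements associate and commute with everything, so a subloop
   contained in the center is normal.  Let q : X1 x X2 -> X1/N1 x X2/N2 be the
   projection.  As N1 x N2 <= A, the subloop A is the full preimage of q(A); if
   M1/N1 and M2/N2 are central then q(A) is central, hence normal, and so is A.
   Conversely, if A is the kernel of f and (x, y) is in A, then
   f(x, 1) = f(1, 1/y), and elements of X1 x 1 commute and associate with
   1 x X2; hence the image of x is central in X1/N1.  Finally q(A) is the graph
   of an isomorphism, because it is a subdirect product of M1/N1 and M2/N2 that
   meets both factors trivially. *)

Set Implicit Arguments.
Unset Strict Implicit.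
Unset Printing Implicit Defensive.

Local Open Scope classical_set_scope.
Local Open Scope group_scope.

(** * Cancellation and loop homomorphisms *)

Lemma loop_mulI (X : loopType) (x : X) : injective (fun y => x * y).
Proof. by move=> y z /= e; rewrite -(ldiv_mul x y) e ldiv_mul. Qed.

Lemma loop_mulIr (X : loopType) (x : X) : injective (fun y => y * x).
Proof. by move=> y z /= e; rewrite -(mul_rdiv y x) e mul_rdiv. Qed.

(** Cancellation in [Y] determines the unit and both divisions from the product. *)
Lemma loop_morphism_of_mul (X Y : loopType) (f : X -> Y) :
  (forall x y, f (x * y) = f x * f y) -> loop_morphism f.
Proof.
move=> fM; split=> //.
- by apply: (@loop_mulI Y (f 1)); rewrite -fM !loop_mul1r.
- by move=> x y; apply: (@loop_mulI Y (f x)); rewrite -fM !mul_ldiv.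
- by move=> x y; apply: (@loop_mulIr Y (f y)); rewrite -fM !rdiv_mul.
Qed.

Lemma loop_morphism_comp (X Y Z : loopType) (f : X -> Y) (g : Y -> Z) :
  loop_morphism f -> loop_morphism g -> loop_morphism (g \o f).
Proof.
move=> fm gm; apply: loop_morphism_of_mul => x y /=.
by rewrite (morph_mul fm) (morph_mul gm).
Qed.

Lemma morph_eq (X Y : loopType) (f : X -> Y) (x y : X) :
  loop_morphism f -> f x = f y <-> f (ldiv x y) = 1.
Proof.
move=> fm; rewrite (morph_ldiv fm); split=> [->|e].
  by rewrite -[X in ldiv _ X]loop_mul1r ldiv_mul.
by rewrite -[RHS](mul_ldiv (f x)) e loop_mul1r.
Qed.

(** * Direct products, images and preimages *)

Lemma pair_mulE (X Y : loopType) (a c : X) (b d : Y) :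
  ((a, b) : X * Y) * (c, d) = (a * c, b * d).
Proof. by []. Qed.

Definition pair_map (X1 X2 Y1 Y2 : Type) (f1 : X1 -> Y1) (f2 : X2 -> Y2)
  (p : X1 * X2) : Y1 * Y2 := (f1 p.1, f2 p.2).

Lemma pair_map_morphism (X1 X2 Y1 Y2 : loopType) (f1 : X1 -> Y1)
    (f2 : X2 -> Y2) :
  loop_morphism f1 -> loop_morphism f2 -> loop_morphism (pair_map f1 f2).
Proof.
move=> fm1 fm2; apply: loop_morphism_of_mul => -[a b] [c d].
by congr (_, _); rewrite /= ?(morph_mul fm1) ?(morph_mul fm2).
Qed.

Lemma sval_morphism (X : loopType) (A : set X) (hA : subloop A) :
  loop_morphism (fun u : subloop_of hA => sval u).
Proof. exact: loop_morphism_of_mul. Qed.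

Lemma image_subloop (X Y : loopType) (f : X -> Y) (A : set X) :
  loop_morphism f -> subloop A -> subloop (f @` A).
Proof.
case=> f1 fM fl fr [A1 AM Al Ar]; split.
- by exists 1.
- by move=> _ _ [x Ax <-] [y Ay <-]; exists (x * y); [exact: AM | exact: fM].
- by move=> _ _ [x Ax <-] [y Ay <-]; exists (ldiv x y); [exact: Al | exact: fl].
- by move=> _ _ [x Ax <-] [y Ay <-]; exists (rdiv x y); [exact: Ar | exact: fr].
Qed.

Lemma preimage_subloop (X Y : loopType) (f : X -> Y) (B : set Y) :
  loop_morphism f -> subloop B -> subloop (f @^-1` B).
Proof.
case=> f1 fM fl fr [B1 BM Bl Br]; split=> [|x y|x y|x y] /=.
- by rewrite /preimage /= f1.
- by rewrite /preimage /= fM; exact: BM.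
- by rewrite /preimage /= fl; exact: Bl.
- by rewrite /preimage /= fr; exact: Br.
Qed.

Lemma preimage_normal (X Y : loopType) (f : X -> Y) (B : set Y) :
  loop_morphism f -> normal B -> normal (f @^-1` B).
Proof.
move=> fm [Z [g [gm ->]]]; exists Z, (g \o f); split=> //.
exact: loop_morphism_comp.
Qed.

Lemma setT_subloop (X : loopType) : subloop [set: X].
Proof. by []. Qed.

(** * Equality in quotient loops *)

Lemma quo_eq1 (X : loopType) (N : set X) (hN : normal N) (x : X) :
  quo hN x = 1 <-> N x.
Proof.
have n1 : N 1 by have [] := normal_subloop hN.
split=> [/(congr1 sval) /= e|Nx].
  have : lcoset N x x by exists 1 => //; exact: loop_mul1r.
  by rewrite e => -[n Nn <-]; rewrite loop_mul1l.
apply: quotient_inj => /=; case: hN => Y [f [fm eN]].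
rewrite !(lcoset_fiber _ fm eN) (morph_one fm).
by move: Nx; rewrite eN /= => ->.
Qed.

Lemma quo_eq (X : loopType) (N : set X) (hN : normal N) (x y : X) :
  quo hN x = quo hN y <-> N (ldiv x y).
Proof. by rewrite (morph_eq _ _ (quo_morphism hN)) quo_eq1. Qed.

(** * Central elements *)

Record central_elt (X : loopType) (c : X) : Prop := CentralElt {
  central_mulC : forall x, x * c = c * x;
  central_mulAl : forall x y, (c * x) * y = c * (x * y);
  central_mulAr : forall x y, x * (y * c) = (x * y) * c
}.

(** Each identity says that [c] is fixed by one of the three families of generators of [Inn]; being
    fixed then passes to composites and inverses. *)
Lemma centerP (X : loopType) (c : X) : center X c <-> central_elt c.
Proof.
split=> [cc|[cC cl cr] f].
  split=> [x|x y|x y].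
  - by rewrite -[RHS](congr1 (fun z => z * x) (cc _ (Inn_RL x))) rdiv_mul.
  - rewrite -[RHS](congr1 (fun z => z * (x * y)) (cc _ (Inn_RR x y))).
    by rewrite rdiv_mul.
  - rewrite -[RHS](congr1 (fun z => (x * y) * z) (cc _ (Inn_LL y x))).
    by rewrite mul_ldiv.
elim=> [x y|x y|x||g h _ gc _ hc|g h _ gc gh _] //=.
- by rewrite cr ldiv_mul.
- by rewrite cl mul_rdiv.
- by rewrite cC mul_rdiv.
- by rewrite hc.
- by rewrite -[LHS](congr1 h gc) gh.
Qed.

(** This is what makes products and divisions of cosets of a central subloop independent of the
    representatives. *)
Lemma central_mulACA (X : loopType) (g h x y : X) :
  central_elt g -> central_elt h -> (x * g) * (y * h) = (x * y) * (g * h).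
Proof.
move=> [gC gl _] [_ _ hr].
by rewrite !hr [x * g]gC gl -gC.
Qed.

Lemma central_pair (X1 X2 : loopType) (c : X1) (d : X2) :
  central_elt c -> central_elt d -> central_elt ((c, d) : X1 * X2).
Proof.
move=> [cC cl cr] [dC dl dr]; split=> [[x y]|[x y] [z w]|[x y] [z w]];
  by rewrite !pair_mulE; congr (_, _).
Qed.

(** * Quotients by chosen representatives, and normality of central subloops *)

(* A loop quotient is encoded by a map r choosing a representative in each
   class; its underlying type is the set of fixed points of r. *)
Record loop_retraction (X : loopType) (r : X -> X) : Prop := LoopRetraction {
  retr_idem : forall x, r (r x) = r x;
  retr_mul : forall x y, r (r x * r y) = r (x * y);
  retr_ldiv : forall x y, r (ldiv (r x) (r y)) = r (ldiv x y);
  retr_rdiv : forall x y, r (rdiv (r x) (r y)) = r (rdiv x y)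
}.

Section Retract.
Variables (X : loopType) (r : X -> X) (hr : loop_retraction r).

(** The type is indexed by the proof of [loop_retraction r] because its loop instance depends on
    that proof. *)
Definition retract (_ : loop_retraction r) : Type := {x : X | r x = x}.
Local Notation Q := (retract hr).

Definition retr (x : X) : Q := exist _ (r x) (retr_idem hr x).

Lemma retract_inj (u v : Q) : sval u = sval v -> u = v.
Proof.
case: u v => [x hx] [y hy] /= e; move: hx hy; rewrite e => hx hy.
by rewrite (Prop_irrelevance hx hy).
Qed.

Lemma svalK : cancel (fun u : Q => sval u) retr.
Proof. by move=> u; apply: retract_inj => /=; exact: svalP u. Qed.

Definition retract_mul (u v : Q) : Q := retr (sval u * sval v).
Definition retract_ldiv (u v : Q) : Q := retr (ldiv (sval u) (sval v)).
Definition retract_rdiv (u v : Q) : Q := retr (rdiv (sval u) (sval v)).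

Lemma retr_mulE x y : retract_mul (retr x) (retr y) = retr (x * y).
Proof. by apply: retract_inj; exact: (retr_mul hr). Qed.

Lemma retr_ldivE x y : retract_ldiv (retr x) (retr y) = retr (ldiv x y).
Proof. by apply: retract_inj; exact: (retr_ldiv hr). Qed.

Lemma retr_rdivE x y : retract_rdiv (retr x) (retr y) = retr (rdiv x y).
Proof. by apply: retract_inj; exact: (retr_rdiv hr). Qed.

HB.instance Definition _ := hasMul.Build Q retract_mul.
HB.instance Definition _ := hasOne.Build Q (retr 1).

Lemma retract_mul_ldiv (u v : Q) : u * retract_ldiv u v = v.
Proof.
by rewrite -(svalK u) -(svalK v) retr_ldivE [LHS]retr_mulE mul_ldiv.
Qed.

Lemma retract_ldiv_mul (u v : Q) : retract_ldiv u (u * v) = v.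
Proof.
by rewrite -(svalK u) -(svalK v) [_ * _]retr_mulE retr_ldivE ldiv_mul.
Qed.

Lemma retract_rdiv_mul (u v : Q) : retract_rdiv u v * v = u.
Proof.
by rewrite -(svalK u) -(svalK v) retr_rdivE [LHS]retr_mulE rdiv_mul.
Qed.

Lemma retract_mul_rdiv (u v : Q) : retract_rdiv (u * v) v = u.
Proof.
by rewrite -(svalK u) -(svalK v) [_ * _]retr_mulE retr_rdivE mul_rdiv.
Qed.

Lemma retract_mul1l (u : Q) : 1 * u = u.
Proof. by rewrite -(svalK u) [LHS]retr_mulE loop_mul1l. Qed.

Lemma retract_mul1r (u : Q) : u * 1 = u.
Proof. by rewrite -(svalK u) [LHS]retr_mulE loop_mul1r. Qed.

HB.instance Definition _ := BaseUMagma_isLoop.Build Q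
  retract_mul_ldiv retract_ldiv_mul retract_rdiv_mul retract_mul_rdiv
  retract_mul1l retract_mul1r.

(** The set is the kernel of [retr]. The unit of the target is [retr 1], and [r 1] may differ from
    1. *)
Lemma retraction_normal : normal [set x | r x = r 1].
Proof.
exists Q, retr; split.
  by apply: loop_morphism_of_mul => x y; rewrite -retr_mulE.
apply/seteqP; split=> x /= e; first exact: retract_inj.
by move/(congr1 sval): e.
Qed.

End Retract.

(** The type [quotient] presupposes normality, so the target loop comes from a retraction: [r] sends
    [x] to a chosen element of the coset [xG], and centrality lets factors from [G] move out of
    products and divisions. *)
Lemma central_subloop_normal (X : loopType) (G : set X) :
  subloop G -> G `<=` center X -> normal G.
Proof.
move=> [G1 GM Gl Gr] sGZ.
have cG g : G g -> central_elt g by move=> /sGZ/centerP.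
(* The value 1 on the empty set is a dummy; [rep] is only applied to cosets, which are nonempty. *)
have /choice[rep repP] (C : set X) : exists y, (exists z, C z) -> C y.
  have [Cn|] := pselect (exists z, C z); last by exists 1.
  by case: Cn => y; exists y.
pose r x := rep (lcoset G x).
have rP x : exists2 g, G g & r x = x * g.
  have [|g Gg e] := repP (lcoset G x); last by exists g.
  by exists x, 1; rewrite ?loop_mul1r.
(* The cosets of [x * g] and [x] are equal as sets, so [rep] chooses the same element. *)
have rM x g : G g -> r (x * g) = r x.
  move=> Gg; congr (rep _); apply/seteqP; split=> z [k Gk <-].
    by exists (g * k); [exact: GM | rewrite (central_mulAr (cG k Gk))].
  exists (ldiv g k); first exact: Gl.
  by rewrite -(central_mulAr (cG _ (Gl _ _ Gg Gk))) mul_ldiv.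
have rr : loop_retraction r.
  split=> [x|x y|x y|x y].
  - by have [g Gg e] := rP x; rewrite [X in r X]e rM.
  - have [[g Gg ->] [h Gh ->]] := (rP x, rP y).
    by rewrite (central_mulACA x y (cG g Gg) (cG h Gh)) rM //; exact: GM.
  - have [[g Gg ->] [h Gh ->]] := (rP x, rP y).
    suff -> : ldiv (x * g) (y * h) = ldiv x y * ldiv g h by apply/rM/Gl.
    apply: (@loop_mulI _ (x * g));
      by rewrite mul_ldiv central_mulACA ?mul_ldiv //; auto.
  - have [[g Gg ->] [h Gh ->]] := (rP x, rP y).
    suff -> : rdiv (x * g) (y * h) = rdiv x y * rdiv g h by apply/rM/Gr.
    apply: (@loop_mulIr _ (y * h));
      by rewrite rdiv_mul central_mulACA ?rdiv_mul //; auto.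
suff -> : G = [set x | r x = r 1] by exact: retraction_normal.
apply/seteqP; split=> x /=.
  by move=> Gx; rewrite -[x]loop_mul1l rM.
(* Equal representatives of [x] and 1 give [x * g = h], so [x = rdiv h g] lies in [G]. *)
have [[g Gg ->] [h Gh ->]] := (rP x, rP 1).
by rewrite loop_mul1l => e; rewrite -(mul_rdiv x g) e; exact: Gr.
Qed.

(** * Subdirect products as graphs, and quotients by equal kernels *)

(** If [(c, d)] and [(c, d')] lie in [G], so does their left quotient [(1, ldiv d d')], whence
    [d = d']; symmetrically in the other coordinate. Thus [G] is functional in both directions. *)
Lemma subdirect_isomorphism (K1 K2 : loopType) (G : set (K1 * K2)) :
  subloop G ->
  (forall c, exists d, G (c, d)) -> (forall d, exists c, G (c, d)) ->
  (forall c, G (c, 1) -> c = 1) -> (forall d, G (1, d) -> d = 1) ->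
  exists phi : K1 -> K2,
    loop_isomorphism phi /\ forall c d, G (c, d) <-> phi c = d.
Proof.
move=> [_ GM Gl _] tot1 tot2 triv1 triv2.
have ldivxx (X : loopType) (x : X) : ldiv x x = 1.
  by rewrite -[X in ldiv _ X]loop_mul1r ldiv_mul.
have eq_ldiv1 (X : loopType) (x y : X) : ldiv x y = 1 -> x = y.
  by move=> e; rewrite -(mul_ldiv x y) e loop_mul1r.
have fun1 c d d' : G (c, d) -> G (c, d') -> d = d'.
  by move=> /Gl h /h; rewrite /ldiv /= /pair_ldiv /= ldivxx => /triv2/eq_ldiv1.
have fun2 c c' d : G (c, d) -> G (c', d) -> c = c'.
  by move=> /Gl h /h; rewrite /ldiv /= /pair_ldiv /= ldivxx => /triv1/eq_ldiv1.
have [phi phiP] := choice tot1.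
have [psi psiP] := choice tot2.
exists phi; split; last first.
  by move=> c d; split=> [|<-]; [exact: fun1 (phiP c) | exact: phiP].
split.
  apply: loop_morphism_of_mul => x y.
  exact: fun1 (phiP _) (GM _ _ (phiP x) (phiP y)).
exists psi => [c|d]; first exact: fun2 (psiP _) (phiP _).
exact: fun1 (phiP _) (psiP _).
Qed.

(** The image of [x] under the pair [(f x, g x)] runs over a subdirect product of [Y] and [Z], which
    meets both factors trivially because the kernels agree. *)
Lemma same_kernel_isomorphic (X Y Z : loopType) (f : X -> Y) (g : X -> Z) :
  loop_morphism f -> loop_morphism g ->
  (forall y, exists x, f x = y) -> (forall z, exists x, g x = z) ->
  (forall x, f x = 1 <-> g x = 1) -> loop_isomorphic Y Z.
Proof.
move=> fm gm fs gs fg.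
have hm : loop_morphism (fun x => (f x, g x) : Y * Z).
  apply: loop_morphism_of_mul => x y.
  by congr (_, _); rewrite /= ?(morph_mul fm) ?(morph_mul gm).
have [||||phi [phi_iso _]] :=
    @subdirect_isomorphism Y Z _ (image_subloop hm (setT_subloop X)).
- by move=> c; have [x <-] := fs c; exists (g x), x.
- by move=> d; have [x <-] := gs d; exists (f x), x.
- by move=> c [x _ [<- /fg]].
- by move=> d [x _ [/fg + <-]].
- by exists phi.
Qed.

(** * Centrality in quotients *)

(** Since [X/N] embeds into [Y] through [g], centrality can be tested on values of [g]; [g x] need
    not be central in all of [Y]. *)
Lemma center_quotient (X Y : loopType) (g : X -> Y) (N : set X)
    (hN : normal N) (x : X) :
  loop_morphism g -> N = [set z | g z = 1] ->
  (forall z, g z * g x = g x * g z) ->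
  (forall z w, (g x * g z) * g w = g x * (g z * g w)) ->
  (forall z w, g z * (g w * g x) = (g z * g w) * g x) ->
  center (quotient hN) (quo hN x).
Proof.
move=> gm eN gC gl gr.
have quog z w : g z = g w -> quo hN z = quo hN w.
  by move/(morph_eq _ _ gm) => e; apply/quo_eq; rewrite eN.
have qM z w : quo hN z * quo hN w = quo hN (z * w).
  by rewrite (morph_mul (quo_morphism hN)).
apply/centerP; split=> [C|C D|C D].
- by have [z ->] := quoP C; rewrite !qM; apply: quog; rewrite !(morph_mul gm).
- have [[z ->] [w ->]] := (quoP C, quoP D).
  by rewrite !qM; apply: quog; rewrite !(morph_mul gm).
- have [[z ->] [w ->]] := (quoP C, quoP D).
  by rewrite !qM; apply: quog; rewrite !(morph_mul gm).
Qed.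

(** As [N] lies in [M], the subloop [M] is the full preimage of [M/N], which is central and hence
    normal. *)
Lemma normal_of_sub_quotient (X : loopType) (M N : set X) (hN : normal N) :
  subloop M -> N `<=` M -> sub_quotient M hN `<=` center (quotient hN) ->
  normal M.
Proof.
move=> sM sNM sMZ.
have -> : M = quo hN @^-1` sub_quotient M hN.
  apply/seteqP; split=> x; first by move=> Mx; exists x.
  move=> [y My /quo_eq/sNM] h; rewrite -(mul_ldiv y x).
  exact: subloop_mul sM _ _ My h.
apply: preimage_normal (quo_morphism hN) _.
by apply: central_subloop_normal => //; exact: sub_quotient_subloop.
Qed.

(** * Normal subloops of a direct product *)

Section Product.
Variables X1 X2 : loopType.

Lemma fst_morphism : loop_morphism (@fst X1 X2).
Proof. exact: loop_morphism_of_mul. Qed.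

Lemma snd_morphism : loop_morphism (@snd X1 X2).
Proof. exact: loop_morphism_of_mul. Qed.

Lemma inl_morphism : loop_morphism (fun x : X1 => (x, 1) : X1 * X2).
Proof.
by apply: loop_morphism_of_mul => x y; congr (_, _); rewrite /= loop_mul1l.
Qed.

Lemma inr_morphism : loop_morphism (fun y : X2 => (1, y) : X1 * X2).
Proof.
by apply: loop_morphism_of_mul => x y; congr (_, _); rewrite /= loop_mul1l.
Qed.

Lemma section1_normal (A : set (X1 * X2)) : normal A -> normal (section1 A).
Proof. exact: preimage_normal inl_morphism. Qed.

Lemma section2_normal (A : set (X1 * X2)) : normal A -> normal (section2 A).
Proof. exact: preimage_normal inr_morphism. Qed.

Lemma normal_sub_quotient1_center (A : set (X1 * X2)) (hA : normal A)
    (hN1 : normal (section1 A)) :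
  sub_quotient (fst @` A) hN1 `<=` center (quotient hN1).
Proof.
move=> _ [_ [[x y] Axy <-] <-] /=.
case: hA => Y [f [fm eA]]; have fM := morph_mul fm.
have fx : f (x, 1) = f (1, rdiv 1 y).
  move: Axy; rewrite eA /= => fxy.
  (* After right multiplication by [f (1, y)] both sides become 1. *)
  apply: (@loop_mulIr Y (f (1, y))); rewrite -!fM.
  by rewrite !pair_mulE !(loop_mul1l, loop_mul1r) rdiv_mul fxy -(morph_one fm).
apply: (@center_quotient _ _ (fun z => f (z, 1))) => [||z|z w|z w].
- exact: loop_morphism_comp inl_morphism fm.
- by rewrite eA.
(* With [f (x, 1)] replaced by [f (1, rdiv 1 y)], both sides are [f] of one and the same pair. *)
- by rewrite fx -!fM !pair_mulE !(loop_mul1l, loop_mul1r).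
- by rewrite fx -!fM !pair_mulE !(loop_mul1l, loop_mul1r).
- by rewrite fx -!fM !pair_mulE !(loop_mul1l, loop_mul1r).
Qed.

Lemma normal_sub_quotient2_center (A : set (X1 * X2)) (hA : normal A)
    (hN2 : normal (section2 A)) :
  sub_quotient (snd @` A) hN2 `<=` center (quotient hN2).
Proof.
move=> _ [_ [[x y] Axy <-] <-] /=.
case: hA => Y [f [fm eA]]; have fM := morph_mul fm.
have fy : f (1, y) = f (rdiv 1 x, 1).
  move: Axy; rewrite eA /= => fxy.
  apply: (@loop_mulIr Y (f (x, 1))); rewrite -!fM.
  by rewrite !pair_mulE !(loop_mul1l, loop_mul1r) rdiv_mul fxy -(morph_one fm).
apply: (@center_quotient _ _ (fun z => f (1, z))) => [||z|z w|z w].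
- exact: loop_morphism_comp inr_morphism fm.
- by rewrite eA.
- by rewrite fy -!fM !pair_mulE !(loop_mul1l, loop_mul1r).
- by rewrite fy -!fM !pair_mulE !(loop_mul1l, loop_mul1r).
- by rewrite fy -!fM !pair_mulE !(loop_mul1l, loop_mul1r).
Qed.

Variables (A : set (X1 * X2)) (M1 : set X1) (M2 : set X2).
Hypotheses (hA : subloop A) (AM : subdirect A M1 M2).
Variables (hN1 : normal (section1 A)) (hN2 : normal (section2 A)).
Hypotheses (cM1 : sub_quotient M1 hN1 `<=` center (quotient hN1))
  (cM2 : sub_quotient M2 hN2 `<=` center (quotient hN2)).

Local Notation q := (pair_map (quo hN1) (quo hN2)).

Lemma quo_pair_morphism : loop_morphism q.
Proof. by apply: pair_map_morphism; exact: quo_morphism. Qed.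

Lemma preimage_quo_pair : q @^-1` (q @` A) = A.
Proof.
apply/seteqP; split=> p; last by move=> Ap; exists p.
case: p => [x y] [[a b] Aab /pair_equal_spec[/quo_eq Nx /quo_eq Ny]].
(* Both factors lie in [A], by the definition of the two sections. *)
have e : ((ldiv a x, 1) * (1, ldiv b y) : X1 * X2) = ldiv (a, b) (x, y).
  by congr (_, _); rewrite /= ?loop_mul1l ?loop_mul1r.
rewrite -(mul_ldiv (a, b) (x, y)); apply: (subloop_mul hA) => //.
by rewrite -e; exact: (subloop_mul hA).
Qed.

Lemma image_quo_pair_normal : normal (q @` A).
Proof.
apply: central_subloop_normal.
  exact: image_subloop quo_pair_morphism hA.
case: AM => _ sAM _ _ _ [[x y] /sAM[/= Mx My] <-].
apply/centerP; apply: central_pair; apply/centerP.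
  by apply: cM1; exists x.
by apply: cM2; exists y.
Qed.

End Product.

(** * The equivalence and the quotient by the graph *)

Theorem proposition3p5 (X1 X2 : loopType) (A : set (X1 * X2))
    (hA : subloop A) :
  (normal A <->
    exists (M1 : set X1) (M2 : set X2),
      [/\ normal M1, normal M2, subdirect A M1 M2 &
        exists (hN1 : normal (section1 A)) (hN2 : normal (section2 A)),
          sub_quotient M1 hN1 `<=` center (quotient hN1) /\
          sub_quotient M2 hN2 `<=` center (quotient hN2)]) /\
  (forall (hAn : normal A) (M1 : set X1) (M2 : set X2)
      (hM1 : normal M1) (hM2 : normal M2)
      (hN1 : normal (section1 A)) (hN2 : normal (section2 A)),
    subdirect A M1 M2 ->
    sub_quotient M1 hN1 `<=` center (quotient hN1) ->
    sub_quotient M2 hN2 `<=` center (quotient hN2) ->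
    exists phi :
        subloop_of (sub_quotient_subloop hN1 (normal_subloop hM1)) ->
        subloop_of (sub_quotient_subloop hN2 (normal_subloop hM2)),
      loop_isomorphism phi /\
      exists hG : normal (graph phi),
        loop_isomorphic (quotient hAn) (quotient hG)).
Proof.
split; first split=> [nA|[M1 [M2 [nM1 nM2 AM [hN1 [hN2 [cM1 cM2]]]]]]].
- have hN1 := section1_normal nA; have hN2 := section2_normal nA.
  have c1 := normal_sub_quotient1_center nA (hN1 := hN1).
  have c2 := normal_sub_quotient2_center nA (hN2 := hN2).
  exists (fst @` A), (snd @` A); split.
  + apply: normal_of_sub_quotient c1.
      exact: image_subloop (fst_morphism _ _) hA.
    by move=> x Ax; exists (x, 1).
  + apply: normal_of_sub_quotient c2.
      exact: image_subloop (snd_morphism _ _) hA.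
    by move=> y Ay; exists (1, y).
  + by split=> // p Ap; split; exists p.
  + by exists hN1, hN2.
- rewrite -(preimage_quo_pair hA hN1 hN2).
  apply: preimage_normal; first exact: quo_pair_morphism.
  exact: (image_quo_pair_normal hA AM cM1 cM2).
move=> hAn M1 M2 hM1 hM2 hN1 hN2 AM cM1 cM2.
set h1 := sub_quotient_subloop _ _; set h2 := sub_quotient_subloop _ _.
pose q := pair_map (quo hN1) (quo hN2).
have qm : loop_morphism q by exact: quo_pair_morphism.
have nqA : normal (q @` A) by exact: (image_quo_pair_normal hA AM cM1 cM2).
have qAE x y : (q @` A) (quo hN1 x, quo hN2 y) <-> A (x, y).
  by rewrite -[in X in _ <-> X](preimage_quo_pair hA hN1 hN2).
have [_ sAM eM1 eM2] := AM.
have lift1 x : M1 x -> exists y, A (x, y).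
  by rewrite -eM1 => -[[{}x y] Axy <-]; exists y.
have lift2 y : M2 y -> exists x, A (x, y).
  by rewrite -eM2 => -[[x {}y] Axy <-]; exists x.
pose G := pair_map (fun u : subloop_of h1 => sval u)
                   (fun v : subloop_of h2 => sval v) @^-1` (q @` A).
have sG : subloop G.
  apply: preimage_subloop.
    by apply: pair_map_morphism; exact: sval_morphism.
  exact: normal_subloop.
have [||||phi [phi_iso phiP]] := subdirect_isomorphism sG.
- move=> [C [x Mx eC]]; have [y Axy] := lift1 x Mx.
  have [_ /= My] := sAM _ Axy.
  have K2y : sub_quotient M2 hN2 (quo hN2 y) by exists y.
  by exists (exist _ _ K2y); rewrite /G /preimage /pair_map /= -eC; apply/qAE.
- move=> [D [y My eD]]; have [x Axy] := lift2 y My.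
  have [/= Mx _] := sAM _ Axy.
  have K1x : sub_quotient M1 hN1 (quo hN1 x) by exists x.
  by exists (exist _ _ K1x); rewrite /G /preimage /pair_map /= -eD; apply/qAE.
(* Here [A (x, 1)] says that [x] lies in N1, so its coset is trivial. *)
- move=> [C [x Mx eC]] /=; subst C => /qAE Ax.
  by apply: subloop_of_inj => /=; apply/quo_eq1.
- move=> [D [y My eD]] /=; subst D => /qAE Ay.
  by apply: subloop_of_inj => /=; apply/quo_eq1.
exists phi; split=> //.
have eG : graph phi = q @` A.
  apply/seteqP; split=> p.
    by move=> [u ->]; exact: (phiP u (phi u)).2.
  move=> [[x y] Axy <-]; have [/= Mx My] := sAM _ Axy.
  have K1x : sub_quotient M1 hN1 (quo hN1 x) by exists x.
  have K2y : sub_quotient M2 hN2 (quo hN2 y) by exists y.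
  exists (exist _ _ K1x); have /phiP -> // : G (exist _ _ K1x, exist _ _ K2y).
  by exists (x, y).
have nG : normal (graph phi) by rewrite eG.
exists nG.
apply: (@same_kernel_isomorphic _ _ _ (quo hAn) (quo nG \o q)).
- exact: quo_morphism.
- exact: loop_morphism_comp qm (quo_morphism nG).
- by move=> C; have [p ->] := quoP C; exists p.
- move=> C; have [[D E] ->] := quoP C.
  by have [[x ->] [y ->]] := (quoP D, quoP E); exists (x, y).
- by move=> [x y]; rewrite /= !quo_eq1 eG; split=> /qAE.
Qed.
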